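(* Let $\{\mathbf{x}^{(k)}\}_{k\ge 1}$ be the sequence generated by the Away-step Stochastic Frank-Wolfe algorithm (ASFW, described in the context, with the batch sizes $m^{(i)}=\lceil 1/(1-\rho)^{2i+2}\rceil$) for solving $\min_{\mathbf{x}\in\mathcal{P}}F(\mathbf{x})$, and let $F^*=\min_{\mathbf{x}\in\mathcal{P}}F(\mathbf{x})$. Let $\beta\in(0,\rho)$ and the deterministic constant $C_2$ be such that $\mathbb{E}\{F(\mathbf{x}^{(k+1)})-F^*\}\le C_2(1-\beta)^{(k-1)/2}$ for every $k\ge1$. Then for some $0<\omega<\beta$, $$\frac{F(\mathbf{x}^{(k)})-F^*}{(1-\omega)^{(k-1)/2}}\longrightarrow 0\quad\text{almost surely as }k\to\infty.$$ Therefore $F(\mathbf{x}^{(k)})$ converges linearly to $F^*$ almost surely.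
   Context: Problem. $\mathcal{P}=\{\mathbf{x}\in\mathbb{R}^p:\mathbf{C}\mathbf{x}\le\mathbf{d}\}$, with $\mathbf{C}\in\mathbb{R}^{m\times p}$ (rows $\mathbf{C}_i$) and $\mathbf{d}\in\mathbb{R}^m$, is a non-empty compact polyhedron with more than one point; $V$ is its finite set of vertices, $D=\sup\{\|\mathbf{x}-\mathbf{y}\|:\mathbf{x},\mathbf{y}\in\mathcal{P}\}$ its diameter. For $i=1,\dots,n$, $f_i:\mathbb{R}^p\to\mathbb{R}$ is strongly convex with parameter $\sigma_i>0$ and differentiable with $L_i$-Lipschitz gradient. $F=\frac1n\sum_{i=1}^n f_i$, $\sigma_F=\min_i\sigma_i$, $L_F=\max_iL_i$. $\xi$ is uniform on $\{1,\dots,n\}$ and $f(i,\mathbf{x})=f_i(\mathbf{x})$. Constants. $\Omega_{\mathcal{P}}=\zeta/\phi$, where $\zeta=\min\{d_i-\mathbf{C}_i\mathbf{v}:\mathbf{v}\in V,\ i\in\{1,\dots,m\},\ d_i>\mathbf{C}_i\mathbf{v}\}$ and $\phi=\max_{i\in\{1,\dots,m\}\setminus I(V)}\|\mathbf{C}_i\|$, with $I(V)=\{i:\mathbf{C}_i\mathbf{v}=d_i\text{ for all }\mathbf{v}\in V\}$. $\rho=\min\{\frac12,\frac{\Omega_{\mathcal{P}}^2\sigma_F}{16N^2L_FD^2}\}$, where $N=p+1$ if the representation update below uses Carathéodory's theorem and $N=|V|$ otherwise. ASFW. Start from $\mathbf{x}^{(1)}\in V$, with weights $\mu^{(1)}_{\mathbf{x}^{(1)}}=1$,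 $\mu^{(1)}_{\mathbf{v}}=0$ for other $\mathbf{v}\in V$, and $U^{(1)}=\{\mathbf{x}^{(1)}\}$. At iteration $k=1,2,\dots$: (1) Draw $\xi_1,\dots,\xi_{m^{(k)}}$ i.i.d. copies of $\xi$ (independent of the past); set $F^{(k)}(\mathbf{x})=\frac1{m^{(k)}}\sum_{i=1}^{m^{(k)}}f(\xi_i,\mathbf{x})$, $\mathbf{g}^{(k)}=\nabla F^{(k)}(\mathbf{x}^{(k)})$, $L^{(k)}=\frac1{m^{(k)}}\sum_{i=1}^{m^{(k)}}L_{\xi_i}$. (2) Choose a vertex $\mathbf{p}^{(k)}\in\arg\min_{\mathbf{x}\in\mathcal{P}}\langle\mathbf{g}^{(k)},\mathbf{x}\rangle$ and $\mathbf{u}^{(k)}\in\arg\max_{\mathbf{v}\in U^{(k)}}\langle\mathbf{g}^{(k)},\mathbf{v}\rangle$. (3) If $\langle\mathbf{g}^{(k)},\mathbf{p}^{(k)}+\mathbf{u}^{(k)}-2\mathbf{x}^{(k)}\rangle\le0$, set $\mathbf{d}^{(k)}=\mathbf{p}^{(k)}-\mathbf{x}^{(k)}$, $\gamma^{(k)}_{\max}=1$; otherwise set $\mathbf{d}^{(k)}=\mathbf{x}^{(k)}-\mathbf{u}^{(k)}$, $\gamma^{(k)}_{\max}=\mu^{(k)}_{\mathbf{u}^{(k)}}/(1-\mu^{(k)}_{\mathbf{u}^{(k)}})$. (4) Set $\gamma^{(k)}=\min\{-\langle\mathbf{g}^{(k)},\mathbf{d}^{(k)}\rangle/(L^{(k)}\|\mathbf{d}^{(k)}\|^2),\gamma^{(k)}_{\max}\}$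 (with $\gamma^{(k)}=0$ if $\mathbf{d}^{(k)}=0$), or determine it by line search, $\gamma^{(k)}\in\arg\min_{0\le\gamma\le\gamma^{(k)}_{\max}}F^{(k)}(\mathbf{x}^{(k)}+\gamma\mathbf{d}^{(k)})$. Set $\mathbf{x}^{(k+1)}=\mathbf{x}^{(k)}+\gamma^{(k)}\mathbf{d}^{(k)}$. (5) Representation update. If $\mathbf{d}^{(k)}=\mathbf{x}^{(k)}-\mathbf{u}^{(k)}$ (away step): $\mu^{(k+1)}_{\mathbf{v}}=\mu^{(k)}_{\mathbf{v}}(1+\gamma^{(k)})$ for $\mathbf{v}\ne\mathbf{u}^{(k)}$, $\mu^{(k+1)}_{\mathbf{u}^{(k)}}=\mu^{(k)}_{\mathbf{u}^{(k)}}(1+\gamma^{(k)})-\gamma^{(k)}$. Otherwise: $\mu^{(k+1)}_{\mathbf{v}}=\mu^{(k)}_{\mathbf{v}}(1-\gamma^{(k)})$ for $\mathbf{v}\neq\mathbf{p}^{(k)}$, $\mu^{(k+1)}_{\mathbf{p}^{(k)}}=\mu^{(k)}_{\mathbf{p}^{(k)}}(1-\gamma^{(k)})+\gamma^{(k)}$. Then $U^{(k+1)}=\{\mathbf{v}\in V:\mu^{(k+1)}_{\mathbf{v}}>0\}$. Optionally, Carathéodory's theorem is then applied to replace this representation $\mathbf{x}^{(k+1)}=\sum_{\mathbf{v}\in U^{(k+1)}}\mu^{(k+1)}_{\mathbf{v}}\mathbf{v}$ by one using a subset of at most $p+1$ of these vertices. ''Converges linearly almost surely'' means that almost surely $F(\mathbf{x}^{(k)})-F^*$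 is $o(r^k)$ for some deterministic $r\in(0,1)$. *)

(* Defs.v *)
From HB Require Import structures.
From mathcomp Require Import all_boot all_order all_algebra finmap.
From mathcomp Require Import all_classical all_reals all_analysis.

Set Implicit Arguments.
Unset Strict Implicit.
Unset Printing Implicit Defensive.

Import Order.TTheory GRing.Theory Num.Theory.
Import numFieldNormedType.Exports.

Local Open Scope classical_set_scope.
Local Open Scope ring_scope.

(* Points of R^p are row vectors.  The norm `|x| of the library on 'rV[R]_p is
   the sup norm (used here only through the topology and differentiability,
   which do not depend on the norm); the Euclidean norm is enorm. *)
Definition dotp (R : realType) (p : nat) (u v : 'rV[R]_p) : R :=
  \sum_(j < p) u 0 j * v 0 j.

Definition enorm (R : realType) (p : nat) (u : 'rV[R]_p) : R :=
  Num.sqrt (dotp u u).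

Definition grad (R : realType) (p : nat) (f : 'rV[R]_p -> R) (x : 'rV[R]_p) :
    'rV[R]_p :=
  \row_(j < p) 'D_(delta_mx 0 j) f x.

Definition strongly_convex (R : realType) (p : nat) (s : R)
    (f : 'rV[R]_p -> R) : Prop :=
  forall (x y : 'rV[R]_p) (t : R), 0 <= t <= 1 ->
    f (t *: x + (1 - t) *: y) <=
      t * f x + (1 - t) * f y - s / 2 * t * (1 - t) * enorm (x - y) ^+ 2.

Definition lipschitz_grad (R : realType) (p : nat) (l : R)
    (f : 'rV[R]_p -> R) : Prop :=
  forall x y : 'rV[R]_p, enorm (grad f x - grad f y) <= l * enorm (x - y).

Definition polyhedron (R : realType) (m p : nat) (C : 'M[R]_(m, p))
    (d : 'cV[R]_m) : set 'rV[R]_p :=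
  [set x | forall i, dotp (row i C) x <= d i 0].

Definition vertices (R : realType) (p : nat) (P : set 'rV[R]_p) :
    set 'rV[R]_p :=
  [set v | P v /\ forall (y z : 'rV[R]_p) (t : R), P y -> P z -> 0 < t < 1 ->
                    v = t *: y + (1 - t) *: z -> y = z].

Definition diameter (R : realType) (p : nat) (P : set 'rV[R]_p) : R :=
  sup [set enorm (xy.1 - xy.2) | xy in P `*` P].

(* Cardinality of a finite set: fset_set sends an infinite set to the empty
   one.  It is only applied to sets of vertices of a polyhedron, which are
   finite. *)
Definition card_set (T : choiceType) (A : set T) : nat := #|` fset_set A |%fset.

(* Below, every min (max) is taken over a finite non-empty set of reals and is
   written as inf (sup). *)

Definition zeta (R : realType) (m p : nat) (C : 'M[R]_(m, p)) (d : 'cV[R]_m) :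
    R :=
  inf [set s | exists v i, [/\ vertices (polyhedron C d) v,
                               dotp (row i C) v < d i 0 &
                               s = d i 0 - dotp (row i C) v]].

Definition always_active (R : realType) (m p : nat) (C : 'M[R]_(m, p))
    (d : 'cV[R]_m) : set 'I_m :=
  [set i | forall v, vertices (polyhedron C d) v -> dotp (row i C) v = d i 0].

Definition phi (R : realType) (m p : nat) (C : 'M[R]_(m, p)) (d : 'cV[R]_m) :
    R :=
  sup [set enorm (row i C) | i in ~` always_active C d].

Definition Omega (R : realType) (m p : nat) (C : 'M[R]_(m, p)) (d : 'cV[R]_m) :
    R :=
  zeta C d / phi C d.

(* carath tells whether the representation update of the algorithm applies
   Caratheodory's theorem. *)
Definition rep_bound (R : realType) (m p : nat) (C : 'M[R]_(m, p))
    (d : 'cV[R]_m) (carath : bool) : nat :=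
  if carath then p.+1 else card_set (vertices (polyhedron C d)).

Definition rho (R : realType) (m p n : nat) (C : 'M[R]_(m, p)) (d : 'cV[R]_m)
    (sigma L : 'I_n -> R) (carath : bool) : R :=
  Num.min (1 / 2)
    (Omega C d ^+ 2 * inf (range sigma) /
      (16 * (rep_bound C d carath)%:R ^+ 2 * sup (range L) *
         diameter (polyhedron C d) ^+ 2)).

Definition batch_size (R : realType) (r : R) (i : nat) : nat :=
  `|Num.ceil (1 / (1 - r) ^+ (2 * i + 2))|%N.

Definition avg (R : realType) (p n : nat) (f : 'I_n -> 'rV[R]_p -> R)
    (y : 'rV[R]_p) : R :=
  n%:R^-1 * \sum_(i < n) f i y.

Definition min_value (R : realType) (p : nat) (F : 'rV[R]_p -> R)
    (P : set 'rV[R]_p) : R :=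
  inf (F @` P).

Section Step.
Context (R : realType) (p : nat).
Implicit Types (V : set 'rV[R]_p) (g x pv u dir : 'rV[R]_p).
Implicit Types (mu : 'rV[R]_p -> R) (gam : R).

(* Weights are functions on R^p of which only the values on V matter. *)
Definition active V mu : set 'rV[R]_p := [set v | V v /\ 0 < mu v].

Definition toward g pv u x : bool := dotp g (pv + u - 2 *: x) <= 0.

Definition direction g pv u x : 'rV[R]_p :=
  if toward g pv u x then pv - x else x - u.

Definition gamma_max g pv u x mu : R :=
  if toward g pv u x then 1 else mu u / (1 - mu u).

Definition new_weight g pv u x mu gam (v : 'rV[R]_p) : R :=
  if toward g pv u x
  then mu v * (1 - gam) + (if v == pv then gam else 0)
  else mu v * (1 + gam) - (if v == u then gam else 0).

Definition short_step g dir (l gmax gam : R) : Prop :=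
  gam = if dir == 0 then 0
        else Num.min (- dotp g dir / (l * enorm dir ^+ 2)) gmax.

Definition line_search (Fk : 'rV[R]_p -> R) x dir (gmax gam : R) : Prop :=
  0 <= gam <= gmax /\
  forall t, 0 <= t <= gmax -> Fk (x + gam *: dir) <= Fk (x + t *: dir).

Definition caratheodory_reduction V (x' : 'rV[R]_p) (mu mu' : 'rV[R]_p -> R) :
    Prop :=
  [/\ (forall v, V v -> 0 <= mu' v),
      \sum_(v \in V) mu' v = 1,
      x' = \sum_(v \in V) mu' v *: v,
      active V mu' `<=` active V mu &
      (card_set (active V mu') <= p.+1)%N].

(* One iteration, from (x, mu) to (x', mu'), with batch s : 'I_b -> 'I_n and
   choices pv, u, gam.  The step size rule is left free at each iteration. *)
Record asfw_step (n : nat) (P : set 'rV[R]_p) (f : 'I_n -> 'rV[R]_p -> R)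
    (L : 'I_n -> R) (carath : bool) (b : nat) (s : 'I_b -> 'I_n)
    x mu pv u gam (x' : 'rV[R]_p) (mu' : 'rV[R]_p -> R) : Prop := AsfwStep {
  step_toward : let g := grad (avg (f \o s)) x in
    vertices P pv /\ forall y, P y -> dotp g pv <= dotp g y;
  step_away : let g := grad (avg (f \o s)) x in
    active (vertices P) mu u /\
    forall v, active (vertices P) mu v -> dotp g v <= dotp g u;
  step_size : let g := grad (avg (f \o s)) x in
    let dir := direction g pv u x in
    let gmax := gamma_max g pv u x mu in
    short_step g dir (b%:R^-1 * \sum_(i < b) L (s i)) gmax gam \/
    line_search (avg (f \o s)) x dir gmax gam;
  step_iterate : let g := grad (avg (f \o s)) x in
    x' = x + gam *: direction g pv u x;
  step_weights : let g := grad (avg (f \o s)) x in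
    let muhat := new_weight g pv u x mu gam in
    if carath then caratheodory_reduction (vertices P) x' muhat mu'
    else forall v, vertices P v -> mu' v = muhat v
}.

End Step.

Section Process.
Context (R : realType) (disp : measure_display) (T : measurableType disp).
Context (Pr : probability T R).

Definition measurable_wrt (G : set (set T)) (X : T -> R) : Prop :=
  forall B : set R, measurable B -> G (X @^-1` B).

Definition vec_measurable_wrt (p : nat) (G : set (set T))
    (X : T -> 'rV[R]_p) : Prop :=
  forall j, measurable_wrt G (fun w => X w 0 j).

Definition is_filtration (G : nat -> set (set T)) : Prop :=
  [/\ forall k, sigma_algebra setT (G k),
      forall k, G k `<=` measurable &
      forall k, G k `<=` G k.+1].

Definition uniform_draw (n : nat) (X : T -> 'I_n) : Prop :=
  forall a, Pr (X @^-1` [set a]) = (n%:R^-1)%:E.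

Definition mutually_independent (n b : nat) (X : 'I_b -> T -> 'I_n) : Prop :=
  forall (J : {set 'I_b}) (A : 'I_b -> set 'I_n),
    Pr (\bigcap_(i in [set` J]) (X i @^-1` A i)) =
      (\prod_(i in J) Pr (X i @^-1` A i))%E.

Definition independent_of (n b : nat) (X : 'I_b -> T -> 'I_n)
    (G : set (set T)) : Prop :=
  forall (A : set T) (S : set ('I_b -> 'I_n)), G A ->
    Pr (A `&` [set w | S (X ^~ w)]) = (Pr A * Pr [set w | S (X ^~ w)])%E.

(* Iterations are numbered from 1; the values at k = 0 are irrelevant, and so
   is xi k i for i >= bs k.  G k is the information available just before the
   batch of iteration k is drawn; the tie-breaking and step-size choices may use
   extra randomness. *)
Record asfw (p n : nat) (P : set 'rV[R]_p) (f : 'I_n -> 'rV[R]_p -> R)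
    (L : 'I_n -> R) (carath : bool) (bs : nat -> nat) (G : nat -> set (set T))
    (xi : nat -> nat -> T -> 'I_n)
    (x : nat -> T -> 'rV[R]_p) (mu : nat -> T -> 'rV[R]_p -> R)
    (pv u : nat -> T -> 'rV[R]_p) (gam : nat -> T -> R) : Prop := Asfw {
  asfw_filtration : is_filtration G;
  asfw_x_adapted : forall k, (1 <= k)%N -> vec_measurable_wrt (G k) (x k);
  asfw_mu_adapted : forall k v, (1 <= k)%N -> vertices P v ->
    measurable_wrt (G k) (fun w => mu k w v);
  asfw_xi_adapted : forall k i (a : 'I_n), (1 <= k)%N -> (i < bs k)%N ->
    G k.+1 (xi k i @^-1` [set a]);
  asfw_pv_adapted : forall k, (1 <= k)%N -> vec_measurable_wrt (G k.+1) (pv k);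
  asfw_u_adapted : forall k, (1 <= k)%N -> vec_measurable_wrt (G k.+1) (u k);
  asfw_gam_adapted : forall k, (1 <= k)%N -> measurable_wrt (G k.+1) (gam k);
  asfw_uniform : forall k i, (1 <= k)%N -> (i < bs k)%N ->
    uniform_draw (xi k i);
  asfw_independent : forall k, (1 <= k)%N ->
    mutually_independent (fun i : 'I_(bs k) => xi k i);
  asfw_past : forall k, (1 <= k)%N ->
    independent_of (fun i : 'I_(bs k) => xi k i) (G k);
  asfw_init_x : forall w, vertices P (x 1%N w);
  asfw_init_mu : forall w v, vertices P v ->
    mu 1%N w v = if v == x 1%N w then 1 else 0;
  asfw_iter : forall k w, (1 <= k)%N ->
    asfw_step P f L carath (fun i : 'I_(bs k) => xi k i w)
      (x k w) (mu k w) (pv k w) (u k w) (gam k w) (x k.+1 w) (mu k.+1 w)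
}.

End Process.

(* Main.v *)
(* Since the rate of E{F(x_k) - min F} is given, only the passage from expectations
   to almost sure convergence remains.  For omega = beta / 2, the expectations of
   the nonnegative variables (F(x_k) - min F) / (1 - omega)^((k-1)/2) are dominated
   by a geometric series, so their sum has finite expectation, is almost surely
   finite, and its terms tend to 0 almost surely.  Nonnegativity holds because
   the weights of the algorithm keep every iterate in the polyhedron. *)
Require Import Defs.
From HB Require Import structures.
From mathcomp Require Import all_boot all_order all_algebra finmap.
From mathcomp Require Import all_classical all_reals all_analysis.
From mathcomp Require Import measurable_realfun ring lra.

Set Implicit Arguments.
Unset Strict Implicit.
Unset Printing Implicit Defensive.

Import Order.TTheory GRing.Theory Num.Theory.
Import numFieldNormedType.Exports.
Local Open Scope classical_set_scope.
Local Open Scope ring_scope.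

(** * Measurability of continuous functions of random vectors *)

(** An open set is the union of the boxes with rational centres and radii that it contains. These
    boxes are indexed by a countable type, and the preimage of each is a finite intersection of
    coordinate events. *)
Lemma measurable_preimage_open (R : realType) (disp : measure_display)
    (T : measurableType disp) (p : nat) (X : T -> 'rV[R]_p) (U : set 'rV[R]_p) :
  (forall j, measurable_fun setT (fun w => X w 0 j)) -> open U ->
  measurable (X @^-1` U).
Proof.
move=> mX oU.
pose box (q : {ffun 'I_p -> rat * rat}) : set 'rV[R]_p :=
  [set y | forall j, ball (ratr (q j).1 : R) (ratr (q j).2) (y 0 j)].
suff -> : X @^-1` U = \bigcup_(q in [set: {ffun 'I_p -> rat * rat}])
    (if `[< box q `<=` U >] then X @^-1` box q else set0).
  apply: countable_bigcupT_measurable => // q.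
  case: ifP => _; last exact: measurable0.
  have -> : X @^-1` box q = \bigcap_(j in [set` finset.setT])
      ((fun w => X w 0 j) @^-1` ball (ratr (q j).1 : R) (ratr (q j).2)).
    apply/seteqP; split=> w; first by move=> qw j _; exact: qw.
    by move=> qw j; apply: qw; rewrite /= finset.in_setT.
  apply: fin_bigcap_measurable => // j _.
  rewrite -[X in measurable X]setTI; apply: mX => //.
  by rewrite ball_itv; exact: measurable_itv.
apply/seteqP; split=> [w Uw|w [q _]]; last by case: asboolP => // qU; exact: qU.
have [B nB BU] : nbhs (X w) U by exact: open_nbhs_nbhs.
have /choice[q qP] : forall j : 'I_p, exists cr : rat * rat,
    ball (ratr cr.1 : R) (ratr cr.2) (X w 0 j) /\
    ball (ratr cr.1 : R) (ratr cr.2) `<=` B 0 j.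
  move=> j; have [|c [r [/set_mem Xcr crB]]] :=
    @open_subball_rat R ((B 0 j)°) (X w 0 j) (open_interior _).
    by rewrite inE; exact: nB.
  by exists (c, r); split=> // y /crB; exact: interior_subset.
exists [ffun j => q j] => //.
rewrite asboolT; first by move=> j; rewrite ffunE; exact: (qP j).1.
move=> y qy; apply: BU => i j; rewrite ord1; apply: (qP j).2.
by have := qy j; rewrite ffunE.
Qed.

Lemma measurable_continuous_comp (R : realType) (disp : measure_display)
    (T : measurableType disp) (p : nat) (X : T -> 'rV[R]_p)
    (F : 'rV[R]_p -> R) :
  (forall j, measurable_fun setT (fun w => X w 0 j)) -> continuous F ->
  measurable_fun setT (F \o X).
Proof.
move=> mX /continuousP cF; apply: (measurability _ (RGenOpens.measurableE R)).
move=> _ [_ [a [b ->]] <-]; rewrite setTI comp_preimage.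
by apply: measurable_preimage_open => //; apply: cF; exact: interval_open.
Qed.

(** * From expectations to almost sure convergence *)

Lemma ae_cvg0_summable_expectation (R : realType) (disp : measure_display)
    (T : measurableType disp) (Pr : probability T R) (Y : nat -> T -> R) :
  (forall k, measurable_fun setT (Y k)) -> (forall k w, 0 <= Y k w) ->
  (\sum_(0 <= k <oo) 'E_Pr[Y k] < +oo)%E ->
  {ae Pr, forall w, Y ^~ w @ \oo --> (0 : R)}.
Proof.
move=> mY Y0 sumY.
have mEY k : measurable_fun setT (EFin \o Y k).
  exact/measurable_EFinP.
have Y0' k w : (0 <= (Y k w)%:E)%E by rewrite lee_fin.
have intY : Pr.-integrable setT (fun w => \sum_(0 <= k <oo) (Y k w)%:E)%E.
  apply/integrableP; split.
    by apply: ge0_emeasurable_sum => [k w _ _|k _]; [exact: Y0'|exact: mEY].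
  under eq_integral do rewrite gee0_abs ?nneseries_ge0//.
  rewrite integral_nneseries//.
  by move: sumY; under eq_eseriesr do rewrite unlock.
apply: filterS (integrable_ae measurableT intY) => w /(_ I) sum_fin.
have sum_lty : (\sum_(0 <= k <oo) (Y k w)%:E < +oo)%E by rewrite ltey_eq sum_fin.
(* Each term is at most the tail of the series that starts with it, and the tails of a finite
   nonnegative series tend to 0. *)
have tail0 := nneseries_tail_cvg sum_lty (fun k _ => Y0' k w).
apply: (@fine_cvg _ _ _ _ (fun k => (Y k w)%:E)).
apply: (squeeze_cvge _ (cvg_cst 0%E) tail0); apply: nearW => k.
rewrite Y0'/= (nneseries_split k 1)// addn1 big_nat1.
by rewrite leeDl// nneseries_ge0.
Qed.

Lemma ae_cvg0_geometric_expectation (R : realType) (disp : measure_display)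
    (T : measurableType disp) (Pr : probability T R) (Z : nat -> T -> R)
    (c a r : R) :
  0 < a < r ->
  (forall k, measurable_fun setT (Z k)) -> (forall k w, 0 <= Z k w) ->
  (forall k, ('E_Pr[Z k] <= (c * a ^+ k)%:E)%E) ->
  {ae Pr, forall w, (fun k => Z k w / r ^+ k) @ \oo --> (0 : R)}.
Proof.
move=> /andP[a0 ar] mZ Z0 EZ.
have r0 : 0 < r by exact: lt_trans ar.
(* The sign of [c] is forced by the bound at [k = 0], where a nonnegative expectation is at most
   [c]. *)
have c0 : 0 <= c.
  have := le_trans (expectation_ge0 Pr (Z0 0%N)) (EZ 0%N).
  by rewrite expr0 mulr1 lee_fin.
have q1 : `|a / r| < 1 by rewrite ger0_norm ?divr_ge0 ?ltW// ltr_pdivrMr ?mul1r.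
apply: (@ae_cvg0_summable_expectation _ _ _ Pr (fun k w => Z k w / r ^+ k)).
- by move=> k; apply: measurable_funM.
- by move=> k w; rewrite divr_ge0 ?exprn_ge0// ltW.
have EZr k : ('E_Pr[fun w => (Z k w / r ^+ k)%R] <= (geometric c (a / r) k)%:E)%E.
  rewrite unlock; under eq_integral do rewrite mulrC EFinM.
  rewrite ge0_integralZl//; last 3 first.
  - exact/measurable_EFinP.
  - by move=> w _; rewrite lee_fin.
  - by rewrite lee_fin invr_ge0 exprn_ge0 ?ltW.
  have -> : geometric c (a / r) k = (r ^+ k)^-1 * (c * a ^+ k).
    by rewrite /= expr_div_n mulrA mulrC.
  rewrite EFinM lee_wpmul2l ?lee_fin ?invr_ge0 ?exprn_ge0 ?(ltW r0)//.
  by have := EZ k; rewrite unlock.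
have geo_lim : (\sum_(0 <= k <oo) (geometric c (a / r) k)%:E <=
    (c / (1 - a / r))%:E)%E.
  apply: lime_le.
    apply: is_cvg_nneseries => k _ _.
    by rewrite lee_fin geometric_ge0// divr_ge0// ltW.
  apply: nearW => k; rewrite sumEFin lee_fin.
  by apply: geometric_le_lim => //; rewrite divr_gt0.
apply: le_lt_trans (ltry (c / (1 - a / r))).
apply: le_trans geo_lim; apply: lee_nneseries => k *; last exact: EZr.
by apply: expectation_ge0 => w; rewrite divr_ge0 ?exprn_ge0// ltW.
Qed.

(** * Inner product and Euclidean norm *)

Section Dotp.
Context (R : realType) (p : nat).
Implicit Types u v w : 'rV[R]_p.

Lemma dotpDr u v w : dotp u (v + w) = dotp u v + dotp u w.
Proof. by rewrite /dotp -big_split; apply: eq_bigr => j _; rewrite mxE mulrDr. Qed.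

Lemma dotpZr (a : R) u v : dotp u (a *: v) = a * dotp u v.
Proof. by rewrite /dotp mulr_sumr; apply: eq_bigr => j _; rewrite mxE mulrCA. Qed.

Lemma dotpBr u v w : dotp u (v - w) = dotp u v - dotp u w.
Proof. by rewrite dotpDr -scaleN1r dotpZr mulN1r. Qed.

Lemma dotp_sumr (I : Type) (s : seq I) (F : I -> 'rV[R]_p) u :
  dotp u (\sum_(i <- s) F i) = \sum_(i <- s) dotp u (F i).
Proof.
elim: s => [|i s IH]; last by rewrite !big_cons dotpDr IH.
by rewrite !big_nil /dotp big1// => j _; rewrite mxE mulr0.
Qed.

Lemma enorm_gt0 u : u != 0 -> 0 < enorm u.
Proof.
move=> u0; rewrite sqrtr_gt0 lt_neqAle sumr_ge0 ?andbT; last first.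
  by move=> j _; rewrite -expr2 sqr_ge0.
apply: contra u0 => /eqP/esym/eqP; rewrite psumr_eq0; last first.
  by move=> j _; rewrite -expr2 sqr_ge0.
move=> /allP uu; apply/eqP/rowP => j; rewrite mxE; apply/eqP.
by have := uu j (mem_index_enum j); rewrite mulf_eq0 orbb.
Qed.

(** The signs of the Lipschitz constants are not hypotheses of the theorem; they follow from the
    existence of two distinct points, and make the short step nonnegative. *)
Lemma lipschitz_grad_ge0 (f : 'rV[R]_p -> R) (l : R) (a b : 'rV[R]_p) :
  a != b -> lipschitz_grad l f -> 0 <= l.
Proof.
move=> ab /(_ a b) /(le_trans (sqrtr_ge0 _)).
by rewrite pmulr_lge0// enorm_gt0// subr_eq0.
Qed.

End Dotp.

(* [s] carries a finite support of the weights explicitly, which spares a proof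
   that a polyhedron has finitely many vertices. *)
Definition convex_rep (R : realType) (p : nat) (V : set 'rV[R]_p)
    (mu : 'rV[R]_p -> R) (x : 'rV[R]_p) (s : seq 'rV[R]_p) : Prop :=
  [/\ [/\ uniq s, (forall v, v \in s -> V v) &
          forall v, V v -> v \notin s -> mu v = 0],
      forall v, V v -> 0 <= mu v,
      \sum_(v <- s) mu v = 1 & x = \sum_(v <- s) mu v *: v].

(** * Operations on convex representations *)

Section ConvexRep.
Context (R : realType) (p : nat).
Implicit Types (V : set 'rV[R]_p) (mu : 'rV[R]_p -> R) (x y : 'rV[R]_p).

(** A vertex outside [s] has weight 0, so adding it to the support changes neither sum. *)
Lemma convex_rep_extend V mu x s y : convex_rep V mu x s -> V y ->
  exists2 t, convex_rep V mu x t & y \in t.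
Proof.
move=> [[us sV mu0] mu_ge0 mu1 ->] Vy; have [ys|ys] := boolP (y \in s).
  by exists s.
exists (y :: s); last exact: mem_head.
split=> //; [split=> //=|..].
- by rewrite ys.
- by move=> v; rewrite in_cons => /predU1P[->|/sV].
- by move=> v Vv; rewrite in_cons negb_or => /andP[_]; exact: mu0.
- by rewrite big_cons mu0// add0r.
- by rewrite big_cons mu0// scale0r add0r.
Qed.

Lemma eq_convex_rep V mu mu' x s : (forall v, V v -> mu' v = mu v) ->
  convex_rep V mu x s -> convex_rep V mu' x s.
Proof.
move=> mumu' [[us sV mu0] mu_ge0 mu1 ->]; split.
- by split=> // v Vv vs; rewrite mumu'// mu0.
- by move=> v Vv; rewrite mumu'// mu_ge0.
- by rewrite -mu1; apply: eq_big_seq => v /sV/mumu'.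
- by apply: eq_big_seq => v /sV/mumu' ->.
Qed.

Lemma convex_rep_le1 V mu x s v : convex_rep V mu x s -> V v -> mu v <= 1.
Proof.
move=> rep Vv; have [t [[ut tV _] mu_ge0 <- _] vt] := convex_rep_extend rep Vv.
rewrite (bigD1_seq v)//= lerDl big_seq_cond sumr_ge0// => i /andP[/tV Vi _].
exact: mu_ge0.
Qed.

(** One lemma for both kinds of step: [b] is the step size in a step toward [y], and its opposite in
    a step away from [y]. As [b] may be negative, the last hypothesis asks that the new weight of
    [y] be nonnegative. *)
Lemma convex_rep_move V mu x s y (a b : R) : convex_rep V mu x s -> V y ->
  a + b = 1 -> 0 <= a -> 0 <= mu y * a + b ->
  exists t, convex_rep V (fun v => mu v * a + (if v == y then b else 0))
                         (a *: x + b *: y) t.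
Proof.
move=> rep Vy ab a0 yab.
have [t [[ut tV mu0] mu_ge0 mu1 ->] yt] := convex_rep_extend rep Vy.
exists t; split.
- split=> // v Vv vt; rewrite mu0// mul0r add0r.
  by case: eqP vt => // ->; rewrite yt.
- by move=> v Vv; case: eqP => [->//|_]; rewrite addr0 mulr_ge0 ?mu_ge0.
- rewrite big_split/= -mulr_suml mu1 mul1r -big_mkcond/= (big_rem y)//=.
  rewrite eqxx big1_seq ?addr0// => v /andP[/eqP ->].
  by rewrite mem_rem_uniqF.
- under [RHS]eq_bigr do rewrite scalerDl mulrC -scalerA.
  rewrite big_split/= -scaler_sumr; congr (_ + _).
  rewrite (bigD1_seq y)//= eqxx big1 ?addr0// => v /negPf ->.
  by rewrite scale0r.
Qed.

Lemma convex_rep_fsum V mu x : (forall v, V v -> 0 <= mu v) ->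
  \sum_(v \in V) mu v = 1 -> x = \sum_(v \in V) mu v *: v ->
  exists s, convex_rep V mu x s.
Proof.
move=> mu_ge0; case: finite_supportP => [_|X XV mu0 _ mu1 ->].
  (* A sum with infinite support is 0 by convention, which contradicts the total weight 1. *)
  by rewrite big_nil => /esym/eqP; rewrite oner_eq0.
exists X; split=> //; first by split=> //; exact: fset_uniq.
(* The support of [mu v *: v] may be smaller than [X], since it omits [v = 0]; it is enough that [X]
   contains it. *)
rewrite (@fsbigE _ _ _ _ _ X)//; last first.
  by move=> v Vv vX; rewrite mu0// scale0r.
by rewrite -big_filter; congr (\sum_(_ <- _) _); apply/all_filterP/allP => v /XV;
  rewrite inE.
Qed.

End ConvexRep.

Lemma convex_rep_polyhedron (R : realType) (m p : nat) (C : 'M[R]_(m, p))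
    (d : 'cV[R]_m) (mu : 'rV[R]_p -> R) x s :
  convex_rep (vertices (polyhedron C d)) mu x s -> polyhedron C d x.
Proof.
move=> [[us sV _] mu_ge0 mu1 ->] i.
rewrite dotp_sumr -[leRHS]mul1r -mu1 mulr_suml big_seq [leRHS]big_seq.
apply: ler_sum => v /sV Vv; rewrite dotpZr ler_wpM2l ?mu_ge0//.
by have [] := Vv.
Qed.

(** * Descent directions and admissible step sizes *)

Section StepSize.
Context (R : realType) (p : nat).
Implicit Types (g x pv u dir : 'rV[R]_p) (mu : 'rV[R]_p -> R).

(** An away step is taken only when [dotp g (x - u)] is smaller than [dotp g (pv - x)], which is
    nonpositive because [pv] minimizes over [P]. *)
Lemma direction_descent (P : set 'rV[R]_p) g pv u x :
  P x -> (forall y, P y -> dotp g pv <= dotp g y) ->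
  dotp g (direction g pv u x) <= 0.
Proof.
move=> Px pmin; have := pmin x Px; rewrite /direction /toward.
rewrite dotpBr dotpDr dotpZr; case: ifP => [_|/negbT]; rewrite dotpBr; first lra.
by rewrite -ltNge; lra.
Qed.

Lemma gamma_max_ge0 g pv u x mu : 0 <= mu u <= 1 -> 0 <= gamma_max g pv u x mu.
Proof.
move=> /andP[mu0 mu1]; rewrite /gamma_max; case: ifP => // _.
by rewrite divr_ge0// subr_ge0.
Qed.

Lemma step_size_itv (Fk : 'rV[R]_p -> R) g x dir (l gmax gam : R) :
  0 <= l -> 0 <= gmax -> dotp g dir <= 0 ->
  short_step g dir l gmax gam \/ line_search Fk x dir gmax gam ->
  0 <= gam <= gmax.
Proof.
move=> l0 gmax0 gd [->|[]//]; case: eqP => _; first by rewrite lexx.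
rewrite ge_min lexx orbT andbT le_min gmax0 andbT.
by rewrite divr_ge0 ?oppr_ge0// mulr_ge0// sqr_ge0.
Qed.

End StepSize.

(** * Feasibility of the iterates *)

Lemma asfw_step_convex_rep (R : realType) (p n b : nat) (P : set 'rV[R]_p)
    (f : 'I_n -> 'rV[R]_p -> R) (L : 'I_n -> R) (carath : bool)
    (s : 'I_b -> 'I_n) x mu pv u gam x' mu' t :
  (forall i, 0 <= L i) -> P x -> convex_rep (vertices P) mu x t ->
  asfw_step P f L carath s x mu pv u gam x' mu' ->
  exists t', convex_rep (vertices P) mu' x' t'.
Proof.
move=> L0 Px rep [[Vpv pv_min] [[Vu mu_u] _] gamP -> wts].
case: carath wts => [[mu'0 mu'1 -> _ _]|wts]; first exact: convex_rep_fsum.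
set g := grad _ x in pv_min gamP wts *.
have [_ mu_ge0 _ _] := rep.
have mu_u1 := convex_rep_le1 rep Vu.
have gmax0 : 0 <= gamma_max g pv u x mu by rewrite gamma_max_ge0 ?mu_ge0.
have l0 : 0 <= b%:R^-1 * \sum_(i < b) L (s i).
  by rewrite mulr_ge0 ?invr_ge0 ?sumr_ge0.
have /andP[gam0] :=
  step_size_itv l0 gmax0 (direction_descent u Px pv_min) gamP.
move: wts; rewrite /gamma_max /direction /new_weight; case: ifP => _ wts gam1.
  have [|||t' rep'] := @convex_rep_move _ _ _ _ _ _ pv (1 - gam) gam rep Vpv.
  - by rewrite subrK.
  - by rewrite subr_ge0.
  - by rewrite addr_ge0// mulr_ge0 ?mu_ge0 ?subr_ge0.
  exists t'; apply: eq_convex_rep wts _.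
  rewrite [X in convex_rep _ _ X](_ : _ = (1 - gam) *: x + gam *: pv)//.
  by rewrite scalerBl scale1r scalerBr addrA addrAC.
have [|||t' rep'] := @convex_rep_move _ _ _ _ _ _ u (1 + gam) (- gam) rep Vu.
- by rewrite addrK.
- by rewrite addr_ge0.
(* If [mu u = 1], the bound on [gam] divides by 0, but the new weight of [u] is [1 + gam - gam = 1]
   whatever [gam] is. Otherwise [gam * (1 - mu u) <= mu u] is the required inequality. *)
- move: gam1; have [-> _|mu1] := eqVneq (mu u) 1; first by rewrite mul1r addrK.
  have mu_lt1 : 0 < 1 - mu u by rewrite subr_gt0 lt_neqAle mu1.
  by rewrite ler_pdivlMr//; lra.
exists t'; have -> : x + gam *: (x - u) = (1 + gam) *: x + (- gam) *: u.
  by rewrite scalerDl scale1r scalerBr addrA scaleNr.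
apply: eq_convex_rep rep' => v Vv; rewrite wts//.
by case: ifP => _; rewrite ?subr0 ?addr0.
Qed.

Lemma asfw_iterate_in (R : realType) (disp : measure_display)
    (T : measurableType disp) (Pr : probability T R) (m p n : nat)
    (C : 'M[R]_(m, p)) (d : 'cV[R]_m) f (L : 'I_n -> R) carath bs G xi x mu pv u
    gam :
  (forall i, 0 <= L i) ->
  asfw Pr (polyhedron C d) f L carath bs G xi x mu pv u gam ->
  forall k w, (1 <= k)%N -> polyhedron C d (x k w).
Proof.
move=> L0 run [//|k] w _.
suff [t] : exists t, convex_rep (vertices (polyhedron C d)) (mu k.+1 w) (x k.+1 w) t.
  exact: convex_rep_polyhedron.
have Vx1 := asfw_init_x run w; have mu1 := asfw_init_mu run w.
elim: k => [|k [t rep]]; last first.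
  apply: (asfw_step_convex_rep L0 _ rep (asfw_iter run w _)) => //.
  exact: convex_rep_polyhedron rep.
exists [:: x 1%N w]; split.
- split=> // [v|v Vv]; first by rewrite mem_seq1 => /eqP ->.
  by rewrite mem_seq1 mu1// => /negPf ->.
- by move=> v Vv; rewrite mu1//; case: ifP.
- by rewrite big_seq1 mu1// eqxx.
- by rewrite big_seq1 mu1// eqxx scale1r.
Qed.

(** An infimum is a lower bound only for a set that is bounded below; here the bound is the minimum
    attained by a continuous function on a compact set. *)
Lemma min_value_le (R : realType) (p : nat) (F : 'rV[R]_p -> R)
    (P : set 'rV[R]_p) y :
  compact P -> continuous F -> P y -> min_value F P <= F y.
Proof.
move=> cP cF Py.
have [|c _ cmin] := @EVT_min_rV R p F P (ex_intro _ y Py) cP.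
  exact: continuous_subspaceT.
apply: (@ge_inf _ (F @` P)); last exact: imageP.
by exists (F c) => _ [z Pz <-]; apply: cmin; rewrite inE.
Qed.

Lemma continuous_avg (R : realType) (p n : nat) (f : 'I_n -> 'rV[R]_p -> R) :
  (forall i, continuous (f i)) -> continuous (avg f).
Proof.
move=> cf; have cs : continuous (fun z => \sum_(i < n) f i z).
  by apply: continuous_big => [|i _]; [exact: add_continuous|exact: cf].
have c1 : continuous (fun _ : 'rV[R]_p => n%:R^-1 : R) by exact: cst_continuous.
move=> y; exact: (continuousM (c1 y) (cs y)).
Qed.

Theorem corollary2 (R : realType) (disp : measure_display)
  (T : measurableType disp) (Pr : probability T R)
  (m p n : nat) (n_gt0 : (0 < n)%N)
  (C : 'M[R]_(m, p)) (d : 'cV[R]_m)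
  (P_compact : compact (polyhedron C d))
  (P_two : exists a b, [/\ polyhedron C d a, polyhedron C d b & a != b])
  (f : 'I_n -> 'rV[R]_p -> R) (sigma L : 'I_n -> R)
  (sigma_gt0 : forall i, 0 < sigma i)
  (f_strong : forall i, strongly_convex (sigma i) (f i))
  (f_diff : forall i y, differentiable (f i) y)
  (f_lip : forall i, lipschitz_grad (L i) (f i))
  (carath : bool)
  (G : nat -> set (set T)) (xi : nat -> nat -> T -> 'I_n)
  (x : nat -> T -> 'rV[R]_p) (mu : nat -> T -> 'rV[R]_p -> R)
  (pv u : nat -> T -> 'rV[R]_p) (gam : nat -> T -> R)
  (x_asfw : asfw Pr (polyhedron C d) f L carath
              (batch_size (rho C d sigma L carath)) G xi x mu pv u gam)
  (beta C2 : R)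
  (beta_itv : 0 < beta < rho C d sigma L carath)
  (beta_rate : forall k, (1 <= k)%N ->
     ('E_Pr[fun w => (avg f (x k.+1 w) - min_value (avg f) (polyhedron C d))%R]
      <= (C2 * (1 - beta) `^ (k.-1%:R / 2))%:E)%E) :
  (exists2 omega : R, 0 < omega < beta &
     {ae Pr, forall w,
       (fun k => (avg f (x k w) - min_value (avg f) (polyhedron C d)) /
                 (1 - omega) `^ (k.-1%:R / 2)) @ \oo --> (0 : R)}) /\
  (exists2 r : R, 0 < r < 1 &
     {ae Pr, forall w,
       (fun k => avg f (x k w) - min_value (avg f) (polyhedron C d))
         =o_\oo (fun k : nat => r ^+ k)}).
Proof.
have [a0 [b0 [_ _ ab0]]] := P_two.
have L_ge0 i : 0 <= L i := lipschitz_grad_ge0 ab0 (f_lip i).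
have cF : continuous (avg f).
  by apply: continuous_avg => i y; apply: differentiable_continuous.
set Fmin := min_value _ _ in beta_rate *.
(* The given rate starts with the second iterate; after this shift by two the exponent in the bound
   on [Z k] is exactly [k / 2]. *)
pose Z k w := avg f (x k.+2 w) - Fmin.
have Z0 k w : 0 <= Z k w.
  rewrite subr_ge0; apply: min_value_le => //.
  exact: (asfw_iterate_in L_ge0 x_asfw).
have mZ k : measurable_fun setT (Z k).
  apply: measurable_funB => //.
  apply: (@measurable_continuous_comp _ _ _ _ (x k.+2)) => // j _ B mB.
  rewrite setTI; have [_ sub _] := asfw_filtration x_asfw.
  by apply: (sub k.+2); exact: (asfw_x_adapted x_asfw).
have [beta0 beta_rho] := andP beta_itv.
(* The minimum with 1/2 in [rho] keeps [1 - beta] positive, so that its real powers are powers of a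
   positive square root. *)
have beta_half : beta < 1 / 2.
  by rewrite (lt_le_trans beta_rho)// ge_min lexx.
pose omega := beta / 2.
pose a := Num.sqrt (1 - beta); pose r := Num.sqrt (1 - omega).
have powR_half (y : R) k : 0 <= y -> y `^ (k%:R / 2) = Num.sqrt y ^+ k.
  by move=> y0; rewrite mulrC powRrM powR12_sqrt// powR_mulrn// sqrtr_ge0.
have om1 : 0 < 1 - omega by rewrite /omega; lra.
have r0 : 0 < r by rewrite sqrtr_gt0.
have r1 : r < 1 by rewrite -sqrtr1 ltr_sqrt// /omega; lra.
have ar : 0 < a < r by rewrite sqrtr_gt0 ltr_sqrt// /omega; lra.
have Zcvg : {ae Pr, forall w, (fun k => Z k w / r ^+ k) @ \oo --> (0 : R)}.
  apply: (ae_cvg0_geometric_expectation (c := C2) ar) => // k.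
  have := beta_rate k.+1 isT; rewrite powR_half//; lra.
have Xcvg : {ae Pr, forall w, (fun k => (avg f (x k w) - Fmin) /
    (1 - omega) `^ (k.-1%:R / 2)) @ \oo --> (0 : R)}.
  (* For the iterate [k.+2] the denominator is [r ^+ k.+1], while [Zcvg] divides by [r ^+ k]: hence
     the constant factor [r^-1]. *)
  apply: filterS Zcvg => w /(cvgM (cvg_cst r^-1)); rewrite mulr0.
  rewrite -[X in _ -> X](cvg_shiftn 2) /=; apply: cvg_trans; apply: near_eq_cvg.
  apply: nearW => k /=.
  by rewrite addn2 /= powR_half ?(ltW om1)// -/r exprS invfM mulrCA.
split; first by exists omega => //; rewrite /omega; lra.
exists r; first by rewrite r0.
apply: filterS Xcvg => w Xw; apply/eqoP => e e0.
(* The tolerance [e * r] absorbs the shift of exponent from [k - 1] to [k], since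
   [r * r ^+ (k - 1) = r ^+ k] for [k >= 1]. *)
have /cvgr0Pnorm_le /(_ (e * r)) := Xw; rewrite mulr_gt0// => /(_ isT).
rewrite near_simpl; apply: filterS2 (nbhs_infty_gt 0) => -[//|k] _ /=.
rewrite powR_half ?(ltW om1)// -/r normrM normfV ler_pdivrMr ?normr_gt0 ?expf_neq0 ?gt_eqF//.
by rewrite !normrX (gtr0_norm r0) -mulrA -exprS.
Qed.
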